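(* Let $K\subseteq\mathbf{R}^n$ be a nonempty closed set and let $f=(f_1,\dots,f_s):\mathbf{R}^n\to\mathbf{R}^s$ be a vector polynomial with $\deg f_i=d_i\ge 1$ for $i=1,\dots,s$. Assume that one of the following conditions holds: (i) $SOL^{s}(K_\infty,f^\infty)=\{0\}$; (ii) there exists $i_0\in\{1,\dots,s\}$ such that $SOL(K_\infty,f^\infty_{i_0})=\{0\}$. Then $SOL^{s}(K,f)$ is nonempty.
   Context: $\mathbf{R}^s_+$ is the nonnegative orthant. For a nonempty closed set $C\subseteq\mathbf{R}^n$ and a vector polynomial $h:\mathbf{R}^n\to\mathbf{R}^s$, $SOL^{s}(C,h)$ (Pareto efficient solutions) is the set of $x^*\in C$ such that $h(x)-h(x^* )\notin-\mathbf{R}^s_+\setminus\{0\}$ for all $x\in C$. For a scalar polynomial $q$, $SOL(C,q)$ is the set of global minimizers of $q$ over $C$. The asymptotic cone of $K$ is $K_\infty=\{v\in\mathbf{R}^n:\text{ there exist } t_k\to+\infty \text{ and } x_k\in K \text{ with } x_k/t_k\to v\}$. For a vector polynomial $p=(p_1,\dots,p_s)$ with $\deg p_i=d_i$, $p^\infty=(p_1^\infty,\dots,p_s^\infty)$ where $p_i^\infty(x)=\lim_{\lambda\to+\infty}p_i(\lambda x)/\lambda^{d_i}$. *)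

(* Defs.v *)
From HB Require Import structures.
From mathcomp Require Import all_boot all_order all_algebra.
From mathcomp Require Import all_classical all_reals all_analysis.
From mathcomp Require Import -(notations) mpoly.

Set Implicit Arguments.
Unset Strict Implicit.
Unset Printing Implicit Defensive.

Import Order.TTheory GRing.Theory Num.Theory.
Import numFieldNormedType.Exports.

Local Open Scope classical_set_scope.
Local Open Scope ring_scope.

Definition nonneg_orthant (R : realType) (s : nat) : set 'rV[R]_s :=
  [set y | forall i, 0 <= y ord0 i].

Definition pareto_sol (R : realType) (n s : nat) (C : set 'rV[R]_n)
    (h : 'rV[R]_n -> 'rV[R]_s) : set 'rV[R]_n :=
  [set x0 | C x0 /\ forall x, C x ->
    ~ ((-%R @` @nonneg_orthant R s) `\` [set 0]) (h x - h x0)].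

Definition scalar_sol (R : realType) (n : nat) (C : set 'rV[R]_n)
    (q : 'rV[R]_n -> R) : set 'rV[R]_n :=
  [set x0 | C x0 /\ forall x, C x -> q x0 <= q x].

Definition asymptotic_cone (R : realType) (n : nat) (K : set 'rV[R]_n) :
    set 'rV[R]_n :=
  [set v | exists (t : nat -> R) (x : nat -> 'rV[R]_n),
    [/\ t k @[k --> \oo] --> +oo,
        forall k, K (x k)
      & (t k)^-1 *: x k @[k --> \oo] --> v]].

(* msize p is 1 + the total degree of p, and 0 for p = 0; hence the zero
   polynomial gets degree 0 and is excluded by any hypothesis deg p >= 1. *)
Definition mpoly_degree (R : realType) (n : nat) (p : mpoly n R) : nat :=
  (msize p).-1.

Definition polyfun (R : realType) (n : nat) (p : mpoly n R)
    (x : 'rV[R]_n) : R :=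
  meval (fun j => x ord0 j) p.

Definition vpolyfun (R : realType) (n s : nat) (f : 'I_s -> mpoly n R)
    (x : 'rV[R]_n) : 'rV[R]_s :=
  \row_i polyfun (f i) x.

(* The limit always exists (it is the value at x of the homogeneous component
   of p of top degree), so the totality of lim plays no role. *)
Definition recession (R : realType) (n : nat) (p : mpoly n R)
    (x : 'rV[R]_n) : R :=
  lim (polyfun p (l *: x) / l ^+ mpoly_degree p @[l --> +oo]).

Definition vrecession (R : realType) (n s : nat) (f : 'I_s -> mpoly n R)
    (x : 'rV[R]_n) : 'rV[R]_s :=
  \row_i recession (f i) x.

(* Main.v *)
Require Import Defs.
From HB Require Import structures.
From mathcomp Require Import all_boot all_order all_algebra.
From mathcomp Require Import all_classical all_reals all_analysis.
From mathcomp Require Import -(notations) mpoly.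
From mathcomp Require Import ring.

Set Implicit Arguments.
Unset Strict Implicit.
Unset Printing Implicit Defensive.

Import Order.TTheory GRing.Theory Num.Theory.
Import numFieldNormedType.Exports.

Local Open Scope classical_set_scope.
Local Open Scope ring_scope.

(* Any point x0 of K has a compact section {x in K | f x <= f x0}. Otherwise
   points of the section tending to infinity, divided by their norms, accumulate
   at some v != 0 in the asymptotic cone, and dividing f_i <= f_i x0 by the d_i-th
   power of the norms gives f_i^oo(v) <= 0 = f_i^oo(0) for all i. This contradicts
   (ii) since v would minimize f_{i_0}^oo; under (i) efficiency of 0 first forces
   f^oo(v) = f^oo(0), so that v is efficient too. A minimizer of the sum of the f_i
   over the section is then Pareto efficient on the whole of K. *)

(* For t != 0, p(t u) / t^d = q(t^-1, u), where q(s, u) is the homogenization of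
   p; q is jointly continuous and the recession function is q(0, .). *)
Definition homogenization (R : realType) (n : nat) (p : mpoly n R) (s : R)
    (u : 'rV[R]_n) : R :=
  \sum_(m <- msupp p) mcoeff m p *
    (s ^+ (mpoly_degree p - mdeg m) * \prod_i u ord0 i ^+ m i).

Lemma mdeg_le_degree (R : realType) (n : nat) (p : mpoly n R)
    (m : multinom n) : m \in msupp p -> (mdeg m <= mpoly_degree p)%N.
Proof. by move/msize_mdeg_lt; rewrite /mpoly_degree; case: (msize p). Qed.

Lemma polyfun_homogenization (R : realType) (n : nat) (p : mpoly n R) (t : R)
    (u : 'rV[R]_n) : t != 0 ->
  polyfun p (t *: u) / t ^+ mpoly_degree p = homogenization p t^-1 u.
Proof.
move=> t0; rewrite /polyfun mevalE big_distrl /=; apply: eq_big_seq => m mp.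
have -> : \prod_i (t *: u) ord0 i ^+ m i =
    t ^+ mdeg m * \prod_i u ord0 i ^+ m i.
  rewrite mdegE -prodrXr -big_split.
  by apply: eq_bigr => i _; rewrite mxE exprMn.
(* The truncated subtraction in the exponent is a true one here, since monomials of the support have
   degree at most that of [p]. *)
rewrite -[in LHS](subnK (mdeg_le_degree mp)) exprD exprVn.
move: (expf_neq0 (mpoly_degree p - mdeg m) t0) (expf_neq0 (mdeg m) t0).
move: (\prod_i _) (t ^+ _) (t ^+ mdeg m) => c a b a0 b0; field.
by rewrite a0 b0.
Qed.

(** An arbitrary filter is allowed so that one lemma covers sequences, real limits at infinity and
    neighbourhoods of a point. *)
Lemma homogenization_cvg (R : realType) (n : nat) (p : mpoly n R) (T : Type)
    (F : set_system T) {FF : Filter F} (s : T -> R) (u : T -> 'rV[R]_n)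
    (s0 : R) (v : 'rV[R]_n) : s @ F --> s0 -> u @ F --> v ->
  homogenization p (s x) (u x) @[x --> F] --> homogenization p s0 v.
Proof.
move=> cs cu; apply: cvg_big => [|m _]; first exact: add_continuous.
apply: cvgM; first exact: cvg_cst.
apply: cvgM; first exact: continuous_cvg (@exprn_continuous _ _ _) cs.
apply: cvg_big => [|i _]; first exact: mul_continuous.
apply: (continuous_cvg _ (@exprn_continuous _ _ _)).
exact: continuous_cvg (@coord_continuous _ _ _ _ _ _) cu.
Qed.

(** The first argument of the homogenization is [(t x)^-1], which tends to 0. A constant [u] yields
    the recession function; a varying [u] is needed along unbounded sequences. *)
Lemma polyfun_scaled_cvg (R : realType) (n : nat) (p : mpoly n R) (T : Type)
    (F : set_system T) {FF : Filter F} (t : T -> R) (u : T -> 'rV[R]_n)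
    (v : 'rV[R]_n) : t @ F --> +oo -> u @ F --> v ->
  polyfun p (t x *: u x) / t x ^+ mpoly_degree p @[x --> F] -->
    homogenization p 0 v.
Proof.
move=> ct cu.
have tgt0 : \forall x \near F, 0 < t x by move/cvgryPgt: ct; apply.
have ct' : (t x)^-1 @[x --> F] --> (0 : R) by apply/gtr0_cvgV0.
apply: cvg_trans; last exact: (homogenization_cvg ct' cu).
apply: near_eq_cvg; near=> x.
by rewrite polyfun_homogenization// gt_eqF//; near: x.
Unshelve. all: by end_near. Qed.

Lemma recessionE (R : realType) (n : nat) (p : mpoly n R) (v : 'rV[R]_n) :
  recession p v = homogenization p 0 v.
Proof.
apply/cvg_lim => //; apply: polyfun_scaled_cvg; first exact: cvg_id.
exact: cvg_cst.
Qed.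

Lemma recession0 (R : realType) (n : nat) (p : mpoly n R) :
  (1 <= mpoly_degree p)%N -> recession p 0 = 0.
Proof.
move=> dp; rewrite recessionE /homogenization big_seq big1// => m mp.
under eq_bigr do rewrite mxE.
by rewrite prodrXr -mdegE -exprD subnK ?mdeg_le_degree// expr0n gtn_eqF// mulr0.
Qed.

Lemma polyfun_continuous (R : realType) (n : nat) (p : mpoly n R) :
  continuous (polyfun p).
Proof.
have -> : polyfun p = homogenization p 1.
  apply/funext => u; rewrite -[in RHS]invr1.
  by rewrite -polyfun_homogenization ?oner_neq0// scale1r expr1n divr1.
move=> v.
have FF : Filter (nbhs v) := nbhs_filter (v : 'rV[R]_n).
apply: (@homogenization_cvg R n p _ _ FF (fun=> 1) id 1 v _ cvg_id).
exact: cvg_cst.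
Qed.

(** Points of [A] with norms beyond every integer are normalized, and the unit sphere is compact. *)
Lemma unbounded_direction (R : realType) (n : nat) (A : set 'rV[R]_n) :
  ~ bounded_set A ->
  exists (t : nat -> R) (u : nat -> 'rV[R]_n) (v : 'rV[R]_n),
    [/\ t @ \oo --> +oo, u @ \oo --> v, v != 0 & forall k, A (t k *: u k)].
Proof.
move=> nbA.
have large (M : R) : exists2 x, A x & M < `|x|.
  apply: contrapT => nx; apply: nbA; exists M; split; first exact: num_real.
  move=> N MN x Ax /=; apply/ltW/le_lt_trans/MN.
  by rewrite leNgt; apply/negP => Mx; apply: nx; exists x.
have /choice[x xP] : forall k : nat, exists x, A x /\ k%:R < `|x|.
  by move=> k; have [x Ax kx] := large k%:R; exists x.
have x_neq0 k : `|x k| != 0 by rewrite gt_eqF// (le_lt_trans _ (xP k).2).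
pose u k := `|x k|^-1 *: x k.
pose S := [set w : 'rV[R]_n | `|w| = 1].
have uS k : S (u k) by rewrite /S /= normrZ normfV normr_id mulVf.
have cS : compact S.
  apply: bounded_closed_compact.
    exists 1; split; first exact: num_real.
    by move=> M M1 w /= ->; exact: ltW.
  have -> : S = Num.norm @^-1` [set 1 : R] by [].
  move/continuous_closedP: (@norm_continuous R 'rV[R]_n); apply.
  exact: closed_eq.
have [v [Sv uv]] : S `&` cluster (u @ \oo) !=set0.
  apply: (cS (u @ \oo)). by exists 0%N => // k _; exact: uS.
(* A sequence converging to the cluster point is extracted; [g] need not be increasing, as
   [k <= g k] already sends the norms to infinity. *)
have /choice[g gP] : forall k : nat, exists j,
    (k <= j)%N /\ `|v - u j| < k.+1%:R^-1.
  move=> k; have [] := uv (u @` [set j | (k <= j)%N]) (ball v k.+1%:R^-1).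
  - by exists k => // j /= kj; exists j.
  - by apply: nbhsx_ballx; rewrite invr_gt0.
  by move=> _ [[j /= kj <-]]; rewrite -ball_normE /= => ?; exists j.
exists (fun k => `|x (g k)|), (fun k => u (g k)), v; split.
- apply/cvgryPge => M; near=> k; rewrite (@le_trans _ _ k%:R)//.
    by near: k; exact: nbhs_infty_ger.
  by rewrite ltW// (le_lt_trans _ (xP (g k)).2)// ler_nat (gP k).1.
- apply/cvgrPdist_lt => e e0; near=> k; apply: lt_trans (gP k).2 _.
  by near: k; exact: (near_infty_natSinv_lt (PosNum e0)).
- by rewrite -normr_eq0 Sv oner_neq0.
- by move=> k; rewrite /u scalerA mulfV// scale1r; exact: (xP _).1.
Unshelve. all: by end_near. Qed.

Lemma sublevel_compact (R : realType) (n s : nat) (K : set 'rV[R]_n)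
    (f : 'I_s -> mpoly n R) (c : 'I_s -> R) : closed K ->
  (forall i, (1 <= mpoly_degree (f i))%N) ->
  (forall v, asymptotic_cone K v -> (forall i, recession (f i) v <= 0) ->
    v = 0) ->
  compact (K `&` [set x | forall i, polyfun (f i) x <= c i]).
Proof.
move=> K_closed deg_ge1 Kf; apply: bounded_closed_compact; last first.
  apply: closedI => //.
  have -> : [set x | forall i, polyfun (f i) x <= c i] =
      \bigcap_i polyfun (f i) @^-1` [set y | y <= c i].
    by apply/seteqP; split => [x fx i _|x fx i]; exact: fx.
  apply: closed_bigI => i _.
  move/continuous_closedP: (polyfun_continuous (p := f i)); apply.
  exact: closed_le.
apply: contrapT => /unbounded_direction[t [u [v [tt uv /eqP v0 Ktu]]]].
have t_gt0 : \forall k \near \oo, 0 < t k by move/cvgryPgt: tt; apply.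
apply: v0; apply: Kf => [|i].
  exists t, (fun k => t k *: u k); split => //.
    by move=> k; exact: (Ktu k).1.
  (* The scaling cancels only eventually, once [t k] is positive. *)
  apply: cvg_trans uv; apply: near_eq_cvg; near=> k.
  by rewrite scalerA mulVf ?scale1r// gt_eqF//; near: k.
rewrite recessionE.
have tV : (t k)^-1 @[k --> \oo] --> (0 : R) by apply/gtr0_cvgV0.
(* Positive degree makes the constant bound vanish after division by the power of [t k]. *)
have ccvg : c i * (t k)^-1 ^+ mpoly_degree (f i) @[k --> \oo] --> c i * 0.
  apply: cvgM; first exact: cvg_cst.
  have <- : (0 : R) ^+ mpoly_degree (f i) = 0 by rewrite expr0n gtn_eqF.
  exact: continuous_cvg (@exprn_continuous _ _ _) tV.
rewrite mulr0 in ccvg.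
apply: (ler_cvg_to (polyfun_scaled_cvg tt uv) ccvg); near=> k.
rewrite -exprVn ler_wpM2r//; last exact: (Ktu k).2.
by rewrite exprn_ge0// invr_ge0 ltW//; near: k.
Unshelve. all: by end_near. Qed.

(** Turns the cone condition of Pareto efficiency into coordinatewise domination. *)
Lemma dominatedP (R : realType) (s : nat) (y z : 'rV[R]_s) :
  ((-%R @` @nonneg_orthant R s) `\` [set 0]) (y - z) <->
  (forall i, y ord0 i <= z ord0 i) /\ y <> z.
Proof.
split=> [[[w w_ge0 wE] /= yz0]|[yz y_neq_z]]; split.
- move=> i; have := w_ge0 i; have /rowP/(_ i) := wE; rewrite !mxE => wi.
  by rewrite -oppr_le0 wi subr_le0.
- by move=> yz; apply: yz0; rewrite yz subrr.
- by exists (z - y) => [i|]; rewrite ?opprB// !mxE subr_ge0.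
- by move=> /= /eqP; rewrite subr_eq0 => /eqP.
Qed.

Theorem theorem5p1 (R : realType) (n s : nat) (K : set 'rV[R]_n)
    (f : 'I_s -> mpoly n R) (d : 'I_s -> nat)
    (K_nonempty : K !=set0) (K_closed : closed K)
    (f_deg : forall i, mpoly_degree (f i) = d i)
    (d_ge1 : forall i, (1 <= d i)%N)
    (H : pareto_sol (asymptotic_cone K) (vrecession f) = [set 0] \/
         exists i0 : 'I_s,
           scalar_sol (asymptotic_cone K) (recession (f i0)) = [set 0]) :
  pareto_sol K (vpolyfun f) !=set0.
Proof.
have deg_ge1 i : (1 <= mpoly_degree (f i))%N by rewrite f_deg.
have rec0 i : recession (f i) 0 = 0 by exact: recession0.
have Kf v : asymptotic_cone K v -> (forall i, recession (f i) v <= 0) -> v = 0.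
  move=> Kv v_le0; case: H => [|[i0]] solE.
  - have [_ sol0] : pareto_sol (asymptotic_cone K) (vrecession f) 0.
      by rewrite solE.
    have vE : vrecession f v = vrecession f 0.
      apply: contrapT => v_neq; apply: (sol0 _ Kv); apply/dominatedP.
      by split=> // i; rewrite !mxE rec0.
    (* Efficiency of a point of the cone depends only on its objective value, so [v] inherits it
       from 0. *)
    suff : pareto_sol (asymptotic_cone K) (vrecession f) v by rewrite solE.
    by split=> //; rewrite vE.
  - have [_ sol0] : scalar_sol (asymptotic_cone K) (recession (f i0)) 0.
      by rewrite solE.
    suff : scalar_sol (asymptotic_cone K) (recession (f i0)) v by rewrite solE.
    split=> // w Kw; rewrite (le_trans (v_le0 i0))// -(rec0 i0).
    exact: sol0.
have [x0 Kx0] := K_nonempty.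
pose A := K `&` [set x | forall i, polyfun (f i) x <= polyfun (f i) x0].
have [||a aA a_min] := @compact_EVT_min _ _
    (fun x => \sum_i polyfun (f i) x) A _
    (sublevel_compact K_closed deg_ge1 Kf).
- by exists x0; split.
- apply: continuous_subspaceT; apply: continuous_big => [|i _].
    exact: add_continuous.
  exact: polyfun_continuous.
move: aA; rewrite inE => -[Ka a_le].
exists a; split=> // x Kx /dominatedP[x_le x_neq].
have {}x_le i : polyfun (f i) x <= polyfun (f i) a.
  by have := x_le i; rewrite !mxE.
(* A point dominating [a] stays in the section by transitivity, so minimality of [a] applies to
   it. *)
have xA : x \in A.
  by rewrite inE; split=> // i; exact: le_trans (x_le i) (a_le i).
apply: x_neq; apply/rowP => i; rewrite !mxE.
apply/eqP; move: i; apply/forallP.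
(* Termwise inequalities bound the sum at [x] by the sum at [a], with equality only if all terms
   agree; the reverse inequality is minimality of [a]. *)
have /ge_leif <- := leif_sum (fun i (_ : true) => leif_eq (x_le i)).
exact: a_min.
Qed.
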